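(* Let $n\ge1$ and let $W(n)=\{D_\pi:\pi\in S_n\}$. For $\pi,\sigma\in S_n$ with $m=\mathrm{minimal}(\pi,\sigma)$, $$M^{(W(n))}_{D_\pi,D_\sigma}(x)=x^m(1+x)^{n-m}\quad\text{and}\quad R^{(W(n))}_{D_\pi,D_\sigma}=\frac{(-1)^{m-1}}{n\binom{n-1}{m-1}}.$$ Consequently $R^{(W(n))}_{D_\pi,D_\pi}=1/n$, $\operatorname{tr}R^{(W(n))}=(n-1)!$, $M^{(W(n))}_{D_\pi,D_\pi}(x)=x(1+x)^{n-1}$, and $\operatorname{tr}M^{(W(n))}(x)=n!\,x(1+x)^{n-1}$.
   Context: A 4-tuple $(x,y,a,b)$ denotes an edge from peg $x$ at height $a$ to peg $y$ at height $b$ (height 1 is the bottom). For $\pi\in S_n$, $D_\pi=\{e_i=(\pi(i),n+1,1,i):1\le i\le n\}$, a web diagram on $n+1$ pegs; $W(n)$ is the web world of any $D_\pi$ (all diagrams obtained by permuting heights on each peg). Sum: $D\oplus D'=D\cup\{(x',y',a'+p_{x'}(D),b'+p_{y'}(D)):(x',y',a',b')\in D'\}$, with $p_i(D)$ the number of endpoints of $D$ on peg $i$. $\mathrm{rel}(X)$ relabels heights of endpoints of edges of $X$ on each peg by $1,\dots,\ell_i$ preserving relative order. An $\ell$-colouring of $D$ is a surjection from the edges onto $\{1,\dots,\ell\}$; with $D_c(t)$ the edges of colour $t$, $\mathcal{R}(D,c)=\mathrm{rel}(D_c(1))\oplus\cdots\oplus\mathrm{rel}(D_c(\ell))$. $f(D_1,D_2,\ell)$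 is the number of $\ell$-colourings $c$ of $D_1$ with $\mathcal{R}(D_1,c)=D_2$; $M^{(W)}_{D_1,D_2}(x)=\sum_{\ell\ge1}x^\ell f(D_1,D_2,\ell)$ and $R^{(W)}_{D_1,D_2}=\sum_{\ell\ge1}\frac{(-1)^{\ell-1}}{\ell}f(D_1,D_2,\ell)$. For $\pi,\sigma\in S_n$, $\mathrm{minimal}(\pi,\sigma)=1+|\{1\le j<n:\pi^{-1}(\sigma(j+1))<\pi^{-1}(\sigma(j))\}|$ (the number of left-to-right passes through $\pi$ needed to read $\sigma(1),\dots,\sigma(n)$ in order). *)

(* Defs.v *)
From mathcomp Require Export all_boot all_order all_fingroup all_algebra finmap.

Set Implicit Arguments.
Unset Strict Implicit.
Unset Printing Implicit Defensive.

Import GRing.Theory.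

Local Open Scope fset_scope.
Local Open Scope nat_scope.

(* An edge (x, y, a, b) joins peg x at height a to peg y at height b; pegs and
   heights are numbered from 1. *)
Notation edge := (nat * nat * nat * nat)%type.

Definition peg1 (e : edge) : nat := e.1.1.1.
Definition peg2 (e : edge) : nat := e.1.1.2.
Definition height1 (e : edge) : nat := e.1.2.
Definition height2 (e : edge) : nat := e.2.

Notation diagram := {fset edge}.

(* p_i(D) *)
Definition endpoints (D : diagram) (i : nat) : nat :=
  \sum_(e <- D) ((peg1 e == i) + (peg2 e == i)).

(* The common form of all the operations below: height h on peg x becomes
   t x h. *)
Definition map_heights (t : nat -> nat -> nat) (D : diagram) : diagram :=
  [fset ((peg1 e, peg2 e, t (peg1 e) (height1 e), t (peg2 e) (height2 e)) : edge)
     | e in D].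

(* D' is obtained from D by applying to the heights of each peg x a permutation
   t x of {1, ..., p_x(D)}, i.e. an injective map of this finite set to itself. *)
Definition in_web_world (D D' : diagram) : Prop :=
  exists2 t : nat -> nat -> nat,
    forall x : nat,
      {in [pred h | 0 < h <= endpoints D x] &, injective (t x)} /\
      {in [pred h | 0 < h <= endpoints D x],
         forall h, 0 < t x h <= endpoints D x}
    & D' = map_heights t D.

Definition web_sum (D D' : diagram) : diagram :=
  D `|` map_heights (fun x h => h + endpoints D x) D'.

(* The rank, starting from 1, of height h among the endpoints of X on peg x. *)
Definition height_rank (X : diagram) (x h : nat) : nat :=
  \sum_(e <- X) (((peg1 e == x) && (height1 e <= h)) +
                 ((peg2 e == x) && (height2 e <= h))).

Definition relabel (X : diagram) : diagram := map_heights (height_rank X) X.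

(* Colours are numbered from 0: colour t of 'I_l stands for t + 1. *)
Definition is_colouring (D : diagram) (l : nat) (c : {ffun D -> 'I_l}) : bool :=
  [forall t, exists e, c e == t].

Definition colour_class (D : diagram) (l : nat) (c : {ffun D -> 'I_l})
    (t : 'I_l) : diagram :=
  [fset val e | e : D & c e == t].

(* web_sum is associative on web diagrams and fset0 is its neutral element, so
   the bracketing chosen by \big is immaterial. *)
Definition recolour (D : diagram) (l : nat) (c : {ffun D -> 'I_l}) : diagram :=
  \big[web_sum/fset0]_(t < l) relabel (colour_class c t).

(* f(D1, D2, l) *)
Definition ncolourings (D1 D2 : diagram) (l : nat) : nat :=
  #|[set c : {ffun D1 -> 'I_l} | is_colouring c & recolour c == D2]|.

(* The sums over all l >= 1 below may be stopped at the number of edges. *)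
Lemma ncolourings_eq0 (D1 D2 : diagram) (l : nat) :
  #|` D1| < l -> ncolourings D1 D2 l = 0.
Proof.
move=> ltDl; apply/eqP; rewrite cards_eq0; apply/eqP/setP => c; rewrite !inE.
apply/negbTE/negP => /andP[/forallP sc _].
have inv t : exists e, c e = t by have /existsP[e /eqP] := sc t; exists e.
have sub : [set: 'I_l] \subset c @: [set: D1].
  by apply/subsetP => t _; have [e <-] := inv t; apply: imset_f; rewrite inE.
have := leq_trans (subset_leq_card sub) (leq_imset_card _ _).
by rewrite !cardsT card_ord -cardfE leqNgt ltDl.
Qed.

Local Open Scope ring_scope.

Definition M_entry (D1 D2 : diagram) : {poly int} :=
  \sum_(1 <= l < #|` D1|.+1) (ncolourings D1 D2 l)%:R *: 'X^l.

Definition R_entry (D1 D2 : diagram) : rat :=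
  \sum_(1 <= l < #|` D1|.+1) (-1) ^+ l.-1 / l%:R * (ncolourings D1 D2 l)%:R.

(* The matrix with rows and columns indexed by the diagrams of W, listed in the
   enumeration order of W. *)
Definition web_mx (T : Type) (W : {fset diagram}) (F : diagram -> diagram -> T) :
    'M[T]_#|` W| :=
  \matrix_(i, j) F (nth fset0 W i) (nth fset0 W j).

Definition M_mx (W : {fset diagram}) := web_mx W M_entry.
Definition R_mx (W : {fset diagram}) := web_mx W R_entry.

Local Open Scope nat_scope.

(* Indices and values of s are shifted by 1, 'I_n being {0, ..., n-1}. *)
Definition perm_diagram (n : nat) (s : 'S_n) : diagram :=
  [fset (((s i).+1, n.+1, 1, i.+1) : edge) | i : 'I_n].

Definition perm_world (n : nat) : {fset diagram} :=
  [fset perm_diagram s | s : 'S_n].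

(* ordS j is j + 1 when j + 1 < n. *)
Definition minimal (n : nat) (p s : 'S_n) : nat :=
  1 + #|[set j : 'I_n | j.+1 < n & (p^-1)%g (s (ordS j)) < (p^-1)%g (s j)]|.

(* Main.v *)
Require Import Defs.

Set Implicit Arguments.
Unset Strict Implicit.
Unset Printing Implicit Defensive.

Import Order.TTheory GRing.Theory Num.Theory.

Local Open Scope fset_scope.
Local Open Scope nat_scope.

(** Recolouring [perm_diagram p] by [c] sorts its edges along the last peg by
    colour, ties being broken by their original height.  With
    [q = s * p^-1] (apply [s], then [p^-1]), the result is [perm_diagram s] iff
    the sequence of pairs (colour, height) read along [q] is lexicographically
    increasing, i.e. iff the colours read along [q] weakly increase, strictly at
    the descents of [q].  A weakly increasing surjection onto [l] colours is
    determined by its [l - 1] rises among the [n - 1] gaps, and these must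
    contain the [m - 1] descents: hence [f(D_p, D_s, l) = 'C(n - m, l - m)].
    The sum for [R] is then the expansion of the Beta integral of
    [t^(m-1) (1 - t)^(n-m)]. *)

(** * Monotone maps and ranks on ordinals *)

Lemma homo_ord_succ (N : nat) (T : Type) (r : rel T) (f : 'I_N.+1 -> T) :
    transitive r ->
    (forall i : 'I_N, r (f (widen_ord (leqnSn N) i)) (f (lift ord0 i))) ->
  {homo f : i j / i < j >-> r i j}.
Proof.
move=> r_tr rS i [m]; elim: m => //= m IHm ltm; rewrite ltnS => le_im.
have ltmN : m < N by [].
have fm := rS (Ordinal ltmN).
have eq2 : lift ord0 (Ordinal ltmN) = Ordinal ltm by apply: val_inj.
rewrite eq2 in fm; move: le_im; rewrite leq_eqVlt => /orP[/eqP im|lt_im].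
  by have -> : i = widen_ord (leqnSn N) (Ordinal ltmN) by apply: val_inj.
apply: r_tr fm; have ltm' := ltnW ltm.
have -> : widen_ord (leqnSn N) (Ordinal ltmN) = Ordinal ltm' by apply: val_inj.
exact: IHm.
Qed.

Lemma card_ord_lt (N k : nat) : k <= N -> #|[set j : 'I_N | j < k]| = k.
Proof.
move=> lekN; rewrite -sum1dep_card -[RHS]card_ord -sum1_card.
by rewrite (big_ord_widen _ (fun=> 1) lekN).
Qed.

(** An inversion would nest the sublevel set of the later index in that of the earlier one, against
    their sizes. Conversely, for increasing [K] the sublevel set of [K k] is the initial segment
    ending at [k]. *)
Lemma rank_eq_increasing (N : nat) (K : 'I_N -> nat) : injective K ->
  (forall k, #|[set j | K j <= K k]| = k.+1) <-> {homo K : i j / i < j}.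
Proof.
move=> injK; split=> [rankK i j lt_ij | incK k].
  rewrite ltnNge; apply/negP => le_ji.
  have /subset_leq_card : [set l | K l <= K j] \subset [set l | K l <= K i].
    by apply/subsetP => l; rewrite !inE => /leq_trans; apply.
  by rewrite !rankK ltnS leqNgt lt_ij.
rewrite -[RHS](@card_ord_lt N) //; apply: eq_card => j; rewrite !inE ltnS.
apply/idP/idP => [|le_jk].
  by apply: contraLR; rewrite -!ltnNge; apply: incK.
by move: le_jk; rewrite leq_eqVlt => /orP[/eqP/val_inj->|/incK/ltnW].
Qed.

(** * Weakly increasing surjections and their rises *)

Section Staircases.
Variables (N L : nat).
Implicit Types (S T : {set 'I_N}) (d : {ffun 'I_N.+1 -> 'I_L.+1}).

(** Gap [i] lies between positions i and i + 1, written [widen_ord _ i] and [lift ord0 i]. The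
    boolean summand makes the step strict at the gaps in [S] and weak elsewhere. *)
Definition staircase S d : bool :=
  [forall t, exists k, d k == t] &&
  [forall i : 'I_N, (i \in S) + d (widen_ord (leqnSn N) i) <= d (lift ord0 i)].

Definition nrises T (k : nat) : nat := \sum_(i in T) (i < k).

Lemma nrises0 T : nrises T 0 = 0.
Proof. exact: big1. Qed.

Lemma nrisesN T : nrises T N = #|T|.
Proof. by rewrite -sum1_card; apply: eq_bigr => i _; rewrite ltn_ord. Qed.

Lemma nrisesS T (i : 'I_N) : nrises T i.+1 = (i \in T) + nrises T i.
Proof.
rewrite /nrises; under eq_bigr => j _ do rewrite ltnS leq_eqVlt.
rewrite (eq_bigr (fun j : 'I_N => (j == i) + (j < i))) => [|j _]; last first.
  by rewrite -val_eqE; case: ltngtP.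
rewrite big_split /=; congr (_ + _).
have [iT|iT] := boolP (i \in T); last first.
  by apply: big1 => j jT; case: eqP iT => // <-; rewrite jT.
rewrite (bigD1 i) //= eqxx big1 // => j /andP[_ /negbTE ->] //.
Qed.

Lemma nrises_mono T : {homo nrises T : k1 k2 / k1 <= k2}.
Proof.
move=> k1 k2 le_k; apply: leq_sum => i _; case: ltnP => // lt_i.
by rewrite (leq_trans lt_i).
Qed.

(** [inord] returns the intended value as long as [T] has at most [L] elements; below it has exactly
    [L], since all [L + 1] values must be reached. *)
Definition staircase_of T : {ffun 'I_N.+1 -> 'I_L.+1} :=
  [ffun k : 'I_N.+1 => inord (nrises T k)].

Lemma staircase_ofE T (k : 'I_N.+1) :
  #|T| = L -> staircase_of T k = nrises T k :> nat.
Proof.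
move=> cT; rewrite ffunE inordK // ltnS -[X in _ <= X]cT -nrisesN.
by rewrite nrises_mono // -ltnS.
Qed.

(** Discrete intermediate values: [nrises T] climbs from 0 to [#|T|] by steps of at most one, so it
    equals [t] at the first position where it is at least [t]. *)
Lemma nrises_onto T t : t <= #|T| -> exists k : 'I_N.+1, nrises T k = t.
Proof.
rewrite -nrisesN => le_t; have exk : exists k, t <= nrises T k by exists N.
have [k le_tk mink] := ex_minnP exk.
have lekN : k <= N by apply: mink.
exists (Ordinal (lekN : k < N.+1)); apply/eqP; rewrite eqn_leq le_tk andbT /=.
case: k => [|k] in lekN le_tk mink *; first by rewrite nrises0.
rewrite -[k]/(val (Ordinal lekN)) nrisesS /=.
have: ~~ (t <= nrises T k) by apply/negP => /mink; rewrite ltnn.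
by rewrite -ltnNge; case: (_ \in _) => //=; apply: ltnW.
Qed.

Lemma staircase_of_inj :
  {in [set T : {set 'I_N} | #|T| == L] &, injective staircase_of}.
Proof.
move=> T U; rewrite !inE => /eqP cT /eqP cU eqTU; apply/setP => i.
have E k : nrises T (k : 'I_N.+1) = nrises U k.
  by rewrite -!staircase_ofE // eqTU.
have := E (lift ord0 i); rewrite lift0 !nrisesS (E (widen_ord (leqnSn N) i)) /=.
by move/addIn; do 2 case: (_ \in _).
Qed.

(** Surjectivity forces the first value to be 0, the last to be [L], and every rise to be by exactly
    one; so [d] counts its own strict gaps. *)
Lemma staircase_rises S d : staircase S d ->
  exists2 T : {set 'I_N}, (S \subset T) && (#|T| == L) & d = staircase_of T.
Proof.
case/andP => /forallP ontod /forallP /= Sd.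
have mono (i j : 'I_N.+1) : i <= j -> d i <= d j.
  rewrite leq_eqVlt => /orP[/eqP/val_inj-> //|].
  move: i j; apply: (@homo_ord_succ _ _ (fun t u : 'I_L.+1 => t <= u)).
    by move=> ? ? ?; apply: leq_trans.
  by move=> i; apply: leq_trans (Sd i); apply: leq_addl.
pose T := [set i : 'I_N | d (widen_ord (leqnSn N) i) < d (lift ord0 i)].
have dT (k : 'I_N.+1) : d k = nrises T k :> nat.
  case: k => k; elim: k => [|k IHk] ltk.
    rewrite nrises0; apply/eqP; rewrite -leqn0.
    have /existsP[j /eqP dj] := ontod ord0.
    by rewrite -[X in _ <= X]/(val (@ord0 L)) -dj; apply: mono.
  have ltkN : k < N by [].
  have -> /= : Ordinal ltk = lift ord0 (Ordinal ltkN) by apply: val_inj.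
  rewrite -[k]/(val (Ordinal ltkN)) nrisesS.
  have <- : d (widen_ord (leqnSn N) (Ordinal ltkN)) = nrises T k :> nat.
    have ltk' := ltnW ltk; rewrite -(IHk ltk'); congr (val (d _)).
    exact: val_inj.
  set i := Ordinal ltkN; rewrite inE.
  case: ltnP => [lt_d|le_d]; last first.
    by apply/eqP; rewrite eqn_leq le_d mono //= leq_addl.
  (* A jump by two or more would skip the value just above the lower one: by monotonicity no
     position on either side of the gap can take it. *)
  apply/eqP; rewrite eqn_leq lt_d andbT leqNgt; apply/negP => gap.
  have ltL : (d (widen_ord (leqnSn N) i)).+1 < L.+1.
    exact: leq_trans gap (ltnW (ltn_ord _)).
  have /existsP[j /eqP dj] := ontod (Ordinal ltL).
  have [le_j|lt_j] := leqP j i.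
    by have := mono j (widen_ord (leqnSn N) i) le_j; rewrite dj /= ltnn.
  by have := mono (lift ord0 i) j lt_j; rewrite dj /= leqNgt gap.
have cT : #|T| = L.
  apply/eqP; rewrite -nrisesN -[N]/(val (@ord_max N)) -dT.
  rewrite eqn_leq -ltnS ltn_ord /=.
  have /existsP[j /eqP dj] := ontod ord_max.
  by rewrite -[X in X <= _]/(val (@ord_max L)) -dj; apply: mono; rewrite -ltnS.
exists T; last by apply/ffunP => k; apply: val_inj; rewrite /= staircase_ofE.
rewrite cT eqxx andbT; apply/subsetP => i iS; rewrite inE.
by have := Sd i; rewrite iS.
Qed.

Lemma staircase_ofP S T : S \subset T -> #|T| = L -> staircase S (staircase_of T).
Proof.
move=> sST cT; apply/andP; split.
  apply/forallP => t; have [|k nk] := @nrises_onto T t; first by rewrite cT -ltnS.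
  by apply/existsP; exists k; rewrite -val_eqE /= staircase_ofE // nk.
apply/forallP => i; rewrite !staircase_ofE // lift0 nrisesS leq_add2r.
by case: (boolP (i \in S)) => // /(subsetP sST) ->.
Qed.

Lemma card_staircases_supsets S :
  #|[set d | staircase S d]| =
  #|[set T : {set 'I_N} | S \subset T & #|T| == L]|.
Proof.
rewrite -(card_in_imset (f := staircase_of)); last first.
  move=> T U; rewrite !inE => /andP[_ cT] /andP[_ cU].
  by apply: staircase_of_inj; rewrite inE.
apply: eq_card => d; apply/idP/imsetP => [|[T]].
  by rewrite inE => /staircase_rises[T STL ->]; exists T => //; rewrite inE.
by rewrite !inE => /andP[sST /eqP cT] ->; apply: staircase_ofP.
Qed.

End Staircases.

(** * Supersets of a given finite set, counted by size *)

Lemma card_supsets (T : finType) (S : {set T}) (k : nat) :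
  #|[set U : {set T} | S \subset U & #|U| == #|S| + k]| = 'C(#|T| - #|S|, k).
Proof.
have -> : #|T| - #|S| = #|~: S| by rewrite [in RHS]cardsCs setCK.
(* [S :|: B] matches the [k]-subsets [B] of the complement with the supersets [U], the inverse being
   [U :\: S]. *)
rewrite -cards_draws -[RHS](card_in_imset (f := fun B => S :|: B)); last first.
  move=> A B; rewrite !inE => /andP[sA _] /andP[sB _] /setP eqAB.
  apply/setP => x; have := eqAB x; rewrite !inE.
  have [xS _|//] := boolP (x \in S).
  have nS (C : {set T}) : C \subset ~: S -> x \in C = false.
    by move=> sC; apply/negP => /(subsetP sC); rewrite inE xS.
  by rewrite !nS.
apply: eq_card => U; apply/idP/imsetP => [|[B]].
  rewrite inE => /andP[sSU cU]; exists (U :\: S); last first.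
    by rewrite setDE setUIr setUCr setIT; apply/esym/setUidPr.
  by rewrite inE subsetDr cardsD (setIidPr sSU) (eqP cU) addKn eqxx.
rewrite !inE => /andP[sBC /eqP <-] ->; rewrite subsetUl cardsU.
suff -> : S :&: B = set0 by rewrite cards0 subn0 eqxx.
by apply/eqP; rewrite setI_eq0 disjoint_sym disjoints_subset.
Qed.

(** No superset of [S] is smaller than [S], so the terms below [#|S|] vanish and the index can be
    shifted. *)
Lemma sum_supsets (V : zmodType) (T : finType) (S : {set T}) (g : nat -> V) :
  (\sum_(0 <= k < #|T|.+1)
      g k *+ #|[set U : {set T} | S \subset U & #|U| == k]| =
   \sum_(i < (#|T| - #|S|).+1) g (#|S| + i) *+ 'C(#|T| - #|S|, i))%R.
Proof.
have leS : #|S| <= #|T| by apply: max_card.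
rewrite (big_cat_nat (n := #|S|)) ?leqW //= big_nat big1 => [|k /andP[_ ltk]].
  rewrite add0r -[X in (\sum_(X <= _ < _) _)%R]add0n big_addn subSn // big_mkord.
  by apply: eq_bigr => i _; rewrite addnC card_supsets.
rewrite -sum1dep_card big1 //= => U /andP[/subset_leq_card + /eqP cU].
by rewrite cU leqNgt ltk.
Qed.

(** * An alternating binomial sum with reciprocal weights *)

Section AlternatingBinomialSum.
Local Open Scope ring_scope.

(* The integral of t^a (1 - t)^k over [0, 1], expanded by the binomial theorem. *)
Lemma sum_alt_bin_inv (F : numFieldType) (a k : nat) :
  \sum_(i < k.+1) (-1) ^+ i / (a + i).+1%:R *+ 'C(k, i) =
  ((a + k).+1%:R * 'C(a + k, a)%:R)^-1 :> F.
Proof.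
elim: k a => [|k IHk] a.
  rewrite big_ord_recl big_ord0 bin0 addn0 binn addr0 mulr1n !mulr1.
  by rewrite expr0 mul1r.
(* Pascal's rule; under the integral this is (1 - t)^(k+1) = (1 - t)^k - t (1 - t)^k. *)
have E : \sum_(i < k.+2) (-1) ^+ i / (a + i).+1%:R *+ 'C(k.+1, i) =
   \sum_(i < k.+1) (-1) ^+ i / (a + i).+1%:R *+ 'C(k, i) -
   \sum_(i < k.+1) (-1) ^+ i / (a.+1 + i).+1%:R *+ 'C(k, i) :> F.
  rewrite big_ord_recl /= bin0.
  under eq_bigr => i _ do rewrite /= /bump /= add1n binS mulrnDr.
  rewrite big_split /= addrA; congr (_ + _).
    rewrite [RHS]big_ord_recl bin0 big_ord_recr /= bin_small // mulr0n addr0.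
    by congr (_ + _); apply: eq_bigr => i _.
  rewrite -sumrN; apply: eq_bigr => i _.
  by rewrite exprS mulN1r mulNr mulNrn addSnnS.
rewrite {}E !IHk.
(* [D1] and [D2] express the other two binomials through the denominator of the first term, called
   [P] below. *)
have D1 : a.+1%:R * 'C(a.+1 + k, a.+1)%:R =
          (a + k).+1%:R * 'C(a + k, a)%:R :> F.
  by rewrite -!natrM addSn -mul_bin_diag.
have D2 : k.+1%:R * 'C(a + k.+1, a)%:R = (a + k).+1%:R * 'C(a + k, a)%:R :> F.
  by rewrite -!natrM addnS (mul_bin_down (a + k).+1) subSn ?leq_addr // addKn.
have nz m : m.+1%:R != 0 :> F by rewrite pnatr_eq0.
have nzC m l : (l <= m)%N -> 'C(m, l)%:R != 0 :> F.
  by move=> lm; rewrite pnatr_eq0 -lt0n bin_gt0.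
have nz0 : (a + k).+1%:R * 'C(a + k, a)%:R != 0 :> F.
  by rewrite mulf_neq0 // nzC // leq_addr.
have -> : 'C(a.+1 + k, a.+1)%:R =
          (a + k).+1%:R * 'C(a + k, a)%:R / a.+1%:R :> F.
  by rewrite -D1 mulrC mulKf.
have -> : 'C(a + k.+1, a)%:R =
          (a + k).+1%:R * 'C(a + k, a)%:R / k.+1%:R :> F.
  by rewrite -D2 mulrC mulKf.
rewrite addSn addnS; move: nz0; set P := _ * 'C(_, _)%:R => nz0.
rewrite !invfM !invrK mulrCA [in RHS]mulrCA -[X in X - _]mulr1 -mulrBr.
congr (_ * _).
(* Without the common factor [P^-1], what remains is 1 - (a+1)/(a+k+2) = (k+1)/(a+k+2). *)
apply: (mulfI (nz (a + k).+1)); rewrite mulrBr !mulVKf // mulr1 -natrB;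
  last first.
  by rewrite ltnS ltnW // ltnS leq_addr.
by rewrite subSS subSn ?leq_addr // addKn.
Qed.

End AlternatingBinomialSum.

(** * Edges of iterated web sums *)

Definition move_edge (t : nat -> nat -> nat) (e : edge) : edge :=
  (peg1 e, peg2 e, t (peg1 e) (height1 e), t (peg2 e) (height2 e)).

Lemma mem_map_heights (t : nat -> nat -> nat) (D : diagram) (u : edge) :
  reflect (exists2 e, e \in D & u = move_edge t e) (u \in map_heights t D).
Proof. exact: imfsetP. Qed.

Lemma sum_lt_lift0 (l : nat) (t : 'I_l) (f : 'I_l.+1 -> nat) :
  \sum_(v < l.+1 | v < lift ord0 t) f v =
  f ord0 + \sum_(v < l | v < t) f (lift ord0 v).
Proof. by rewrite big_mkcond big_ord_recl /= -big_mkcond. Qed.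

(** The iterated sum nests to the right, so each shift involves the endpoints of a single summand;
    those of a partial sum never have to be computed. *)
Lemma mem_big_web_sum (l : nat) (F : 'I_l -> diagram) (u : edge) :
  u \in \big[web_sum/fset0]_(t < l) F t <->
  exists t, exists2 e, e \in F t &
    u = move_edge (fun x h => h + \sum_(v < l | v < t) endpoints (F v) x) e.
Proof.
elim: l F u => [|l IHl] F u; first by rewrite big_ord0 inE; split=> // -[[]].
rewrite big_ord_recl; split.
  case/fsetUP => [uF0|/mem_map_heights[e /IHl[t [e' e'F ->]] ->]].
    exists ord0, u => //; rewrite /move_edge !big1 ?addn0 //.
    by case: u uF0 => [[[]]].
  exists (lift ord0 t), e' => //.
  by rewrite /move_edge /= !sum_lt_lift0 -!addnA ![endpoints (F ord0) _ + _]addnC.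
case=> t [e eF ->]; apply/fsetUP; case: (unliftP ord0 t) eF => [t' ->|->] eF.
  right; apply/mem_map_heights.
  exists (move_edge (fun x h =>
    h + \sum_(v < l | v < t') endpoints (F (lift ord0 v)) x) e).
    by apply/IHl; exists t', e.
  by rewrite /move_edge /= !sum_lt_lift0 -!addnA ![endpoints (F ord0) _ + _]addnC.
left; rewrite /move_edge !big1 ?addn0 //.
by case: e eF => [[[]]].
Qed.

(** Distinct first pegs prevent two edges from being merged in the image set. *)
Lemma endpoints_map_heights (t : nat -> nat -> nat) (D : diagram) (x : nat) :
  {in D &, injective peg1} -> endpoints (map_heights t D) x = endpoints D x.
Proof.
move=> injD; rewrite /endpoints big_imfset //= => e e' eD e'D [/injD E _ _ _].
exact: E.
Qed.

(** * Permutation diagrams and the effect of a recolouring *)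

Section PermDiagram.
Variable n : nat.
Implicit Types (p s : 'S_n) (i j k : 'I_n).

Definition perm_edge p i : edge := ((p i).+1, n.+1, 1, i.+1).

Lemma perm_edge_in p i : perm_edge p i \in perm_diagram p.
Proof. by apply/imfsetP; exists i. Qed.

Lemma perm_diagramP p (u : edge) :
  reflect (exists i, u = perm_edge p i) (u \in perm_diagram p).
Proof. by apply: (iffP (imfsetP _ _ _ _)) => [[i _ ->]|[i ->]]; exists i. Qed.

Lemma perm_edge_inj p : injective (perm_edge p).
Proof. by move=> i j [_ /val_inj]. Qed.

Lemma card_perm_diagram p : #|` perm_diagram p| = n.
Proof.
rewrite card_imfset /=; last exact: perm_edge_inj.
by rewrite -cardE card_ord.
Qed.

Lemma sum_perm_diagram p (G : edge -> nat) :
  \sum_(e <- perm_diagram p) G e = \sum_i G (perm_edge p i).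
Proof.
rewrite big_imfset /=; last by move=> i j _ _; apply: perm_edge_inj.
by rewrite big_enum.
Qed.

Lemma perm_diagram_inj : injective (@perm_diagram n).
Proof.
move=> p s /fsetP eqps; apply/permP => i.
have /perm_diagramP[j [E /val_inj ij]] : perm_edge p i \in perm_diagram s.
  by rewrite -eqps perm_edge_in.
by rewrite [in RHS]ij; apply: val_inj.
Qed.

Section Recolour.
Variables (p : 'S_n) (l : nat) (c : {ffun perm_diagram p -> 'I_l}).

Definition colour i : 'I_l := c [` perm_edge_in p i].

Lemma mem_colour_class t (u : edge) :
  reflect (exists2 i, colour i = t & u = perm_edge p i) (u \in colour_class c t).
Proof.
apply: (iffP (imfsetP _ _ _ _)) => [[e /=]|[i ci ->]].
  rewrite inE => /eqP ce ->; have /perm_diagramP[i ei] := valP e.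
  by exists i => //; rewrite -ce; congr (c _); apply: val_inj.
by exists [` perm_edge_in p i] => //; rewrite inE; apply/eqP.
Qed.

Lemma sum_colour_class t (G : edge -> nat) :
  \sum_(e <- colour_class c t) G e = \sum_(i | colour i == t) G (perm_edge p i).
Proof.
have -> : colour_class c t = [fset perm_edge p i | i : 'I_n & colour i == t].
  apply/fsetP => u; apply/mem_colour_class/imfsetP => -[i].
    by move=> /eqP ci ->; exists i.
  by rewrite inE => /eqP ci ->; exists i.
rewrite big_imfset //=; last by move=> i j _ _; apply: perm_edge_inj.
by rewrite big_filter big_enum_cond.
Qed.

(* Encodes the lexicographic order on (colour, height). *)
Definition key i : nat := colour i * n + i.

(** Since [i] and [j] are below [n], a difference in colour always dominates. *)
Lemma key_le i j :
  (key j <= key i) =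
  (colour j < colour i) || ((colour j == colour i) && (j <= i)).
Proof.
rewrite /key -val_eqE /=; case: ltngtP => /= [ltc|ltc|->];
  last by rewrite leq_add2l.
  apply: ltnW; apply: (@leq_trans ((colour j).+1 * n)).
    by rewrite mulSn addnC ltn_add2r.
  by apply: leq_trans (leq_addr _ _); rewrite leq_mul2r ltc orbT.
apply/negbTE; rewrite -ltnNge; apply: (@leq_trans ((colour i).+1 * n)).
  by rewrite mulSn addnC ltn_add2r.
by apply: leq_trans (leq_addr _ _); rewrite leq_mul2r ltc orbT.
Qed.

Lemma key_inj : injective key.
Proof.
move=> i j eq_ij; apply/eqP; rewrite -val_eqE eqn_leq.
have := key_le i j; have := key_le j i; rewrite eq_ij leqnn -!val_eqE /=.
by case: ltngtP => //= _ <- <-.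
Qed.

(** By [mem_recolour], the height on the last peg that edge [i] has after recolouring. *)
Definition key_rank i : nat := #|[set j | key j <= key i]|.

(** On the last peg an edge ends up above all edges of smaller colour and above the edges of its own
    colour that were lower: this is its rank for [key]. Its other endpoint is alone on its peg and
    stays at height 1. *)
Lemma mem_recolour (u : edge) :
  u \in recolour c <-> exists i, u = ((p i).+1, n.+1, 1, key_rank i).
Proof.
(* The relabelling of a colour class followed by its shift in the sum; by [ep], relabelling leaves
   the shifts unchanged. *)
pose st (t : 'I_l) x h := height_rank (colour_class c t) x h +
  \sum_(v < l | v < t) endpoints (colour_class c v) x.
have ep v x :
    endpoints (relabel (colour_class c v)) x = endpoints (colour_class c v) x.
  apply: endpoints_map_heights => e e'.
  case/mem_colour_class=> i _ -> /mem_colour_class[j _ ->].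
  by move=> [/val_inj/perm_inj ->].
have moveE i :
    move_edge (st (colour i)) (perm_edge p i) = ((p i).+1, n.+1, 1, key_rank i).
  have neq j : (n.+1 == (p j).+1) = false by rewrite eqSS gtn_eqF.
  have neq' j : ((p j).+1 == n.+1) = false by rewrite eqSS ltn_eqF.
  rewrite /move_edge /st /height_rank /endpoints /= !sum_colour_class.
  rewrite /peg1 /peg2 /=.
  congr (_, _, _, _).
    (* Peg [(p i).+1] meets only edge [i]: its rank there is 1 and the earlier colours shift it by
       0. *)
    rewrite (bigD1 i) //= eqxx /= neq !big1 // => [v ltv|j /andP[_ neq_ji]].
      rewrite sum_colour_class big1 // => j /eqP cj /=; rewrite neq addn0.
      apply/eqP; rewrite eqb0 eqSS val_eqE (inj_eq perm_inj).
      by apply: contraTneq ltv => <-; rewrite -cj ltnn.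
    by rewrite addn0 eqSS val_eqE (inj_eq perm_inj) (negbTE neq_ji).
  (* On the last peg, the smaller colours account for the shift and the remaining edges, of equal
     colour, for the rank within the class. *)
  rewrite /key_rank -sum1dep_card.
  rewrite [RHS](bigID (fun j => colour j < colour i)) /= addnC; congr (_ + _).
    rewrite (partition_big colour (fun v : 'I_l => v < colour i));
      last by move=> j /andP[].
    apply: eq_bigr => v ltv; rewrite sum_colour_class /=.
    apply: eq_big => [j|j _]; last by rewrite neq' eqxx.
    by rewrite key_le; case: eqP => [->|]; rewrite ?ltv ?andbF.
  rewrite big_mkcond [RHS]big_mkcond; apply: eq_bigr => j _.
  rewrite key_le neq' eqxx ltnS.
  by rewrite -val_eqE /=; case: ltngtP => //=; case: leqP.
split.
  case/mem_big_web_sum => t [e /mem_map_heights[e' + ->] ->].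
  case/mem_colour_class=> i <- ->.
  exists i; rewrite -moveE /move_edge /=.
  by rewrite /st !(eq_bigr _ (fun v _ => ep v _)).
case=> i ->; apply/mem_big_web_sum; exists (colour i).
exists (move_edge (height_rank (colour_class c (colour i))) (perm_edge p i)).
  apply/mem_map_heights; exists (perm_edge p i) => //.
  by apply/mem_colour_class; exists i.
rewrite -moveE /move_edge /=.
by rewrite /st !(eq_bigr _ (fun v _ => ep v _)).
Qed.

End Recolour.
End PermDiagram.

(** * Colourings that turn one permutation diagram into another *)

Lemma recolour_eq (n : nat) (p s : 'S_n) (l : nat)
    (c : {ffun perm_diagram p -> 'I_l}) :
  (recolour c = perm_diagram s) <->
  (forall k, key_rank c ((s * p^-1)%g k) = k.+1).
Proof.
split=> [eqs k | rankS].
  (* Recolouring preserves first pegs, so the edge of the target at height [k.+1] comes from the [i]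
     with [p i = s k]. *)
  have /mem_recolour[i [/val_inj sk rk]] : perm_edge s k \in recolour c.
    by rewrite eqs perm_edge_in.
  by rewrite permM sk permK.
apply/fsetP => u; apply/idP/perm_diagramP.
  case/mem_recolour => i ->; exists ((p * s^-1)%g i).
  by rewrite /perm_edge -(rankS ((p * s^-1)%g i)) !permM permKV permK.
case=> k ->; apply/mem_recolour; exists ((s * p^-1)%g k).
by rewrite /perm_edge -(rankS k) !permM permKV.
Qed.

Definition descents (N : nat) (q : 'S_N.+1) : {set 'I_N} :=
  [set i : 'I_N | q (lift ord0 i) < q (widen_ord (leqnSn N) i)].

(** The condition [j.+1 < n] excludes the only index at which [ordS] wraps around, so what is left
    are the gaps of ['I_N]. *)
Lemma minimalE (N : nat) (p s : 'S_N.+1) :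
  minimal p s = #|descents (s * p^-1)%g|.+1.
Proof.
rewrite /minimal add1n; congr _.+1.
have inj_w : injective (widen_ord (leqnSn N)) by move=> i j [/val_inj].
rewrite -(card_imset _ inj_w); apply: eq_card => j; rewrite !inE ltnS.
have ordSw i : ordS (widen_ord (leqnSn N) i) = lift ord0 i.
  by apply: val_inj; rewrite /= modn_small // ltnS.
apply/andP/imsetP => [[ltj dj]|[i + ->]].
  exists (Ordinal ltj); last exact: val_inj.
  rewrite inE !permM -ordSw.
  by have -> : widen_ord (leqnSn N) (Ordinal ltj) = j by apply: val_inj.
by rewrite inE !permM ordSw; split=> //=.
Qed.

(** Reading colours along [q] turns colourings into functions on positions. The target is reached
    iff [key c \o q] increases; tested gap by gap, this is the staircase condition for the descents
    of [q]. *)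
Lemma ncolourings_perm (N L : nat) (p s : 'S_N.+1) :
  ncolourings (perm_diagram p) (perm_diagram s) L.+1 =
  #|[set T : {set 'I_N} | descents (s * p^-1)%g \subset T & #|T| == L]|.
Proof.
set q := (s * p^-1)%g; set S := descents q; rewrite -card_staircases_supsets.
pose E k : perm_diagram p := [` perm_edge_in p (q k)].
have injE : injective E by move=> k k' [_ /val_inj/perm_inj].
have bijE : bijective E.
  by apply: inj_card_bij injE _; rewrite -cardfE card_perm_diagram card_ord.
have [E' EK E'K] := bijE.
pose f (c : {ffun perm_diagram p -> 'I_L.+1}) : {ffun 'I_N.+1 -> 'I_L.+1} :=
  [ffun k => c (E k)].
have bijf : bijective f.
  exists (fun d : {ffun 'I_N.+1 -> 'I_L.+1} => [ffun e => d (E' e)]) => d;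
    apply/ffunP => k; rewrite !ffunE.
    by rewrite E'K.
  by rewrite EK.
rewrite -(on_card_preimset (f := f)); last exact: onW_bij.
apply: eq_card => c; rewrite !inE /staircase; congr (_ && _).
  apply: eq_forallb => t; apply/existsP/existsP => -[e ce].
    by exists (E' e); rewrite ffunE E'K.
  by exists (E e); rewrite ffunE in ce.
have injK : injective (key c \o q).
  exact: inj_comp (@key_inj _ _ _ c) perm_inj.
have rankE k : key_rank c (q k) = #|[set j | (key c \o q) j <= (key c \o q) k]|.
  rewrite /key_rank -[LHS](on_card_preimset (f := q)); last first.
    by apply: onW_bij; exists (q^-1)%g; [apply: permK | apply: permKV].
  by apply: eq_card => j; rewrite !inE.
(* Across a gap the key increases with a larger colour, or with an equal colour if [q] ascends
   there; hence strictness exactly at the descents. *)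
have keyE (i : 'I_N) :
  ((key c \o q) (widen_ord (leqnSn N) i) < (key c \o q) (lift ord0 i)) =
  ((i \in S) + f c (widen_ord (leqnSn N) i) <= f c (lift ord0 i)).
  rewrite ltnNge key_le !ffunE inE -/(colour c (q (lift ord0 i))).
  rewrite -/(colour c (q (widen_ord (leqnSn N) i))) -val_eqE /=.
  have : q (lift ord0 i) != q (widen_ord (leqnSn N) i) :> nat.
    by rewrite val_eqE (inj_eq perm_inj) -val_eqE /= gtn_eqF.
  move: (nat_of_ord (q _)) (nat_of_ord (q _)) => b a.
  move: (nat_of_ord (colour _ _)) (nat_of_ord (colour _ _)) => x y neq_ab.
  have [lt_ab|le_ba] := ltnP a b.
    by rewrite (ltnW lt_ab) andbT add1n orbC -leq_eqVlt -ltnNge.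
  have /negbTE-> : ~~ (a <= b) by rewrite -ltnNge ltn_neqAle eq_sym neq_ab.
  by rewrite andbF orbF -leqNgt.
apply/eqP/forallP => [/recolour_eq rk i | Sf].
  rewrite -keyE; apply: (rank_eq_increasing injK).1 => [k|];
    last by rewrite /= /bump.
  by rewrite -rankE rk.
apply/recolour_eq => k; rewrite rankE; apply: (rank_eq_increasing injK).2.
by apply: homo_ord_succ => [? ? ?|i]; [apply: ltn_trans | rewrite keyE].
Qed.

Lemma card_descents (N : nat) (q : 'S_N.+1) : #|descents q| <= N.
Proof. by rewrite -[X in _ <= X]card_ord max_card. Qed.

Lemma descents1 (N : nat) : descents (1%g : 'S_N.+1) = set0.
Proof. by apply/setP => i; rewrite !inE !perm1 /= ltnNge leqnSn. Qed.

(** Serves both matrices: [g l] is X^l for [M] and (-1)^(l-1)/l for [R]. *)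
Lemma sum_ncolourings (V : zmodType) (N : nat) (p s : 'S_N.+1) (g : nat -> V) :
  let a := #|descents (s * p^-1)%g| in
  (\sum_(1 <= l < #|` perm_diagram p|.+1)
      g l *+ ncolourings (perm_diagram p) (perm_diagram s) l =
   \sum_(i < (N - a).+1) g (a + i).+1 *+ 'C(N - a, i))%R.
Proof.
rewrite card_perm_diagram big_add1 /=.
under eq_bigr => l _ do rewrite ncolourings_perm.
have := sum_supsets (descents (s * p^-1)%g) (fun l => g l.+1).
by rewrite card_ord.
Qed.

(** * The web world of a permutation diagram *)

Lemma endpoints_perm_diagram (n : nat) (p : 'S_n) (x : nat) :
  endpoints (perm_diagram p) x = (0 < x <= n) + (x == n.+1) * n.
Proof.
rewrite /endpoints sum_perm_diagram big_split /= /peg1 /peg2 /=.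
congr (_ + _); last first.
  by rewrite sum_nat_const card_ord mulnC eq_sym.
case: x => [|x]; first by apply: big1.
case: (ltnP x n) => [lt_xn|le_nx]; last first.
  rewrite big1 // => i _; apply/eqP; rewrite eqb0 eqSS neq_ltn.
  by rewrite (leq_trans (ltn_ord _)).
rewrite (bigD1 ((p^-1)%g (Ordinal lt_xn))) //= permKV eqxx big1 // => i ne_i.
apply/eqP; rewrite eqb0 eqSS; apply: contra_neq ne_i => pi.
by apply: (@perm_inj _ p); rewrite permKV; apply: val_inj.
Qed.

(** The pegs 1 to n carry one endpoint each, so heights can be permuted on the last peg only. *)
Lemma in_perm_world (n : nat) (p : 'S_n) (D : diagram) :
  in_web_world (perm_diagram p) D <-> D \in perm_world n.
Proof.
have epn : endpoints (perm_diagram p) n.+1 = n.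
  by rewrite endpoints_perm_diagram ltnn eqxx mul1n.
have ep1 i : endpoints (perm_diagram p) (p i).+1 = 1.
  by rewrite endpoints_perm_diagram /= ltn_ord eqSS ltn_eqF.
split.
  case=> t ht ->.
  have t1 i : t (p i).+1 1 = 1.
    have [_ /(_ 1)] := ht (p i).+1; rewrite ep1 inE => /(_ isT).
    by case: (t _ _) => [|[]].
  have [injt rngt] := ht n.+1; rewrite epn in injt rngt.
  have tn (i : 'I_n) : 0 < t n.+1 i.+1 <= n.
    by apply: rngt; rewrite inE /= ltn_ord.
  have ltg (i : 'I_n) : (t n.+1 i.+1).-1 < n.
    by case/andP: (tn i) => t0; rewrite prednK.
  pose g i := Ordinal (ltg i).
  have injg : injective g.
    move=> i j [/(congr1 succn)].
    rewrite !prednK; try by case/andP: (tn i); case/andP: (tn j).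
    by move/injt; rewrite !inE !ltn_ord => /(_ isT isT) [/val_inj].
  have gE (i : 'I_n) : t n.+1 i.+1 = (g i).+1.
    by rewrite /= prednK //; case/andP: (tn i).
  (* Edge [i] moves to height [(g i).+1] and keeps its first peg, so the new permutation sends [g i]
     to [p i]. *)
  apply/imfsetP; exists ((perm injg)^-1 * p)%g => //.
  apply/fsetP => u; apply/mem_map_heights/perm_diagramP.
    case=> _ /perm_diagramP[i ->] ->; exists (g i).
    by rewrite /move_edge /perm_edge /= t1 gE permM -(permE injg) permK.
  case=> k ->; exists (perm_edge p ((perm injg)^-1%g k)).
    exact: perm_edge_in.
  by rewrite /move_edge /perm_edge /= t1 gE permM -(permE injg) permKV.
case/imfsetP => s _ ->.
(* The empty diagram is treated apart because [inord] below needs a nonempty index type. *)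
case: n => [|n] in p s epn ep1 *.
  exists (fun _ h => h) => [x|]; first by split.
  apply/fsetP => u.
  by apply/perm_diagramP/mem_map_heights => [[[]]|[? /perm_diagramP[[]]]].
(* As [p i = s (q i)], edge [i] must move to height [(q i).+1] on the last peg, which is now
   numbered [n.+2]. *)
pose q := (p * s^-1)%g.
exists (fun x h => if x == n.+2 then (q (inord h.-1)).+1 else h) => [x|].
  have [->|_] := eqVneq x n.+2; last by split.
  rewrite epn; split=> [[|h] [|h'] //|[|h] //]; last first.
    by rewrite !inE => _; rewrite ltn_ord.
  rewrite !inE /= => lth lth' [/val_inj/perm_inj/(congr1 val)].
  by rewrite /= !inordK // => ->.
have neq i : ((p i).+1 == n.+2) = false by rewrite eqSS ltn_eqF.
apply/fsetP => u; apply/perm_diagramP/mem_map_heights.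
  case=> k ->; exists (perm_edge p ((q^-1)%g k)); first exact: perm_edge_in.
  rewrite /move_edge /perm_edge /= neq eqxx inord_val permKV.
  by rewrite -permM invMg invgK mulgKV.
case=> _ /perm_diagramP[i ->] ->; exists (q i).
by rewrite /move_edge /perm_edge /= neq eqxx inord_val -permM mulgKV.
Qed.

Lemma card_perm_world (n : nat) : #|` perm_world n| = n`!.
Proof.
rewrite card_imfset /=; last exact: perm_diagram_inj.
by rewrite -cardE -card_Sn; apply: eq_card.
Qed.

(** * Matrix entries and traces *)

Local Open Scope ring_scope.

Lemma M_entry_perm (n : nat) (p s : 'S_n) : (0 < n)%N ->
  M_entry (perm_diagram p) (perm_diagram s) =
    'X^(minimal p s) * (1 + 'X) ^+ (n - minimal p s).
Proof.
case: n => // N in p s * => _; rewrite minimalE subSS /M_entry.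
under eq_bigr => l _ do rewrite scaler_nat.
rewrite sum_ncolourings addrC exprDn mulr_sumr.
(* The binomial expansion lists the powers of X downwards, the colouring sum upwards. *)
rewrite [RHS](reindex_inj rev_ord_inj) /=; apply: eq_bigr => i _.
rewrite subSS subKn -1?ltnS // expr1n mulr1 bin_sub -1?ltnS // mulrnAr.
by rewrite -exprD addSn.
Qed.

(** With m - 1 descents, the sign (-1)^(m-1) factors out and [sum_alt_bin_inv] applies with a = m -
    1 and k = n - m. *)
Lemma R_entry_perm (n : nat) (p s : 'S_n) : (0 < n)%N ->
  R_entry (perm_diagram p) (perm_diagram s) =
    (-1) ^+ (minimal p s).-1 / (n%:R * 'C(n.-1, (minimal p s).-1)%:R).
Proof.
case: n => // N in p s * => _; rewrite minimalE /R_entry /=.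
under eq_bigr => l _ do rewrite mulr_natr.
rewrite (sum_ncolourings p s (fun l => (-1) ^+ l.-1 / l%:R)) /=.
set a := #|_|; have leaN : (a <= N)%N by apply: card_descents.
have := sum_alt_bin_inv rat a (N - a); rewrite subnKC // => <-.
rewrite mulr_sumr; apply: eq_bigr => i _.
by rewrite exprD -mulrA mulrnAr.
Qed.

Lemma minimal_refl (n : nat) (p : 'S_n) : (0 < n)%N -> minimal p p = 1%N.
Proof. by case: n p => // N p _; rewrite minimalE mulgV descents1 cards0. Qed.

Lemma trace_web_mx_const (T : pzRingType) (W : {fset diagram})
    (F : diagram -> diagram -> T) (v : T) :
  {in W, forall D, F D D = v} -> \tr (web_mx W F) = v *+ #|` W|.
Proof.
move=> Fv; rewrite /mxtrace (eq_bigr (fun=> v)) => [|i _].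
  by rewrite sumr_const card_ord.
by rewrite mxE Fv // mem_nth.
Qed.

Theorem theorem6p8 (n : nat) (hn : (1 <= n)%N) :
  (forall (p : 'S_n) (D : diagram),
     in_web_world (perm_diagram p) D <-> D \in perm_world n) /\
  (forall p s : 'S_n,
     let m := minimal p s in
     M_entry (perm_diagram p) (perm_diagram s) = 'X^m * (1 + 'X) ^+ (n - m) /\
     R_entry (perm_diagram p) (perm_diagram s) =
       (-1) ^+ m.-1 / (n%:R * 'C(n.-1, m.-1)%:R)) /\
  (forall p : 'S_n, R_entry (perm_diagram p) (perm_diagram p) = 1 / n%:R) /\
  \tr (R_mx (perm_world n)) = (n.-1)`!%:R /\
  (forall p : 'S_n,
     M_entry (perm_diagram p) (perm_diagram p) = 'X * (1 + 'X) ^+ n.-1) /\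
  \tr (M_mx (perm_world n)) = n`!%:R * 'X * (1 + 'X) ^+ n.-1.
Proof.
have Rpp (p : 'S_n) : R_entry (perm_diagram p) (perm_diagram p) = 1 / n%:R.
  by rewrite R_entry_perm // minimal_refl //= bin0 mulr1 expr0.
have Mpp (p : 'S_n) :
    M_entry (perm_diagram p) (perm_diagram p) = 'X * (1 + 'X) ^+ n.-1.
  by rewrite M_entry_perm // minimal_refl // subn1.
split; first exact: in_perm_world.
split; first by move=> p s m; rewrite M_entry_perm // R_entry_perm.
do !split => //.
  rewrite (trace_web_mx_const (v := 1 / n%:R)) => [|_ /imfsetP[p _ ->] //].
  rewrite card_perm_world -[LHS]mulr_natl mul1r.
  (* The trace is [n!] copies of 1/n; one factor [n] cancels. *)
  have -> : n`! = (n.-1`! * n)%N.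
    by case: n hn {Rpp Mpp} => // k _; rewrite factS mulnC.
  by rewrite natrM mulfK // pnatr_eq0 -lt0n.
rewrite (trace_web_mx_const (v := 'X * (1 + 'X) ^+ n.-1));
  last by move=> _ /imfsetP[p _ ->].
by rewrite card_perm_world -mulrA mulr_natl.
Qed.
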